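(* For all types $\tau,\sigma\Vdash n$, the coefficient of $m^\otimes_\tau$ in the $m^{\otimes}$-expansion of $H_\sigma$ is \[ a_{\tau\sigma} = \mathcal{M}(H, m^\otimes)_{\tau, \sigma} = |\mathrm{HTBT}(\tau, \sigma)|. \]
   Context: An integer partition is a finite (possibly empty) weakly decreasing sequence of positive integers; $m_k(\lambda)$ is the number of parts of $\lambda$ equal to $k$. A block is an ordered pair of positive integers written $d^m$ (degree $d$, multiplicity $m$). Blocks are ordered by $a^b\ge d^e$ iff $a>d$, or $a=d$ and $b\ge e$. A type is a finite (possibly empty) weakly decreasing sequence of blocks $\tau=(d_1^{r_1},\dots,d_s^{r_s})$; its weight is $|\tau|=\sum_id_ir_i$, and $\tau\Vdash n$ means $|\tau|=n$. For $k\ge1$, $\tau|_k$ denotes the integer partition formed by the multiplicities of the blocks of $\tau$ of degree $k$. The tensor diagram of $\tau$ is the sequence of partition diagrams $\mathrm{dg}(\tau|_1)\otimes\mathrm{dg}(\tau|_2)\otimes\cdots$; the $k$th component has left-justified rows of boxes of lengths the parts of $\tau|_k$. Variables: $x_{k,j}$ for $k,j\ge 1$, with $\deg x_{k,j}=k$; $\mathbf{x}_{k*}=(x_{k,1},x_{k,2},\dots)$. The graded algebra $\mathsf{P\Lambda}=\bigoplus_n\mathsf{P\Lambda}^n$ of polysymmetric functions consists of the formal series over $\mathbb{Q}$ of bounded degree in all the $x_{k,j}$ that, for each fixed $k$, are unchanged by any permutation of the variables $\mathbf{x}_{k*}$. Define $m^{\otimes}_\tau=\prod_{k\ge1}m_{\tau|_k}(\mathbf{x}_{k*})$,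 where $m_\lambda$ is the monomial symmetric function; $\{m^\otimes_\tau:\tau\Vdash n\}$ is a basis of $\mathsf{P\Lambda}^n$. $H_d$ is the sum of all distinct monomials of degree $d$ in the variables $x_{k,j}$ (with $\deg x_{k,j}=k$), $H_{d^r}$ is obtained from $H_d$ by replacing every variable $x_{k,j}$ by $x_{k,j}^r$, and $H_\sigma=\prod_{i=1}^sH_{d_i^{r_i}}$ for $\sigma=(d_1^{r_1},\dots,d_s^{r_s})$. The transition matrix is defined by $H_\sigma=\sum_{\tau\Vdash n}\mathcal{M}(H,m^\otimes)_{\tau,\sigma}m^\otimes_\tau$ for $\sigma\Vdash n$; $a_{\tau\sigma}$ is simply another notation for the coefficient $\mathcal{M}(H,m^\otimes)_{\tau,\sigma}$. For $\sigma=(d_1^{r_1},\dots,d_s^{r_s})$, $\mathrm{HTBT}(\tau,\sigma)$ is the set of $H$-tensor brick tabloids of shape $\tau$ and content $\sigma$: coverings of the tensor diagram of $\tau$ by labeled horizontal bricks (height $1$, each lying within a single row of a component, every box covered by exactly one brick) built as follows. Choose partitions $\lambda^{(i)}$ of $d_i$ for $i=1,\dots,s$. For each $k\ge1$, the $k$th component $\mathrm{dg}(\tau|_k)$ is covered using exactly $m_k(\lambda^{(i)})$ bricks labeled $i$, each of length $r_i$, for each $i=1,\dots,s$. The labels must weakly increase from left to right in each row. Bricks with the same label are indistinguishable. *)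

(* Defs.v *)
From HB Require Import structures.
From mathcomp Require Import all_boot all_order all_algebra.
From mathcomp Require Import finmap.
From mathcomp Require Import boolp classical_sets functions cardinality fsbigop.
From mathcomp Require Import monalg.

Set Implicit Arguments.
Unset Strict Implicit.
Unset Printing Implicit Defensive.

Import GRing.Theory.

Local Open Scope classical_set_scope.

Definition posn := {n : nat | (0 < n)%N}.
Coercion nat_of_posn (k : posn) : nat := val k.

Definition intpart :=
  {l : seq posn | sorted (fun a b : posn => (b <= a)%N) l}.

Definition psize (l : intpart) : nat := (\sum_(p <- val l) p)%N.

(* A block d^m is the pair (d, m). *)
Definition block := (posn * posn)%type.

Definition block_ge (b c : block) : bool :=
  (c.1 < b.1)%N || ((b.1 == c.1) && (c.2 <= b.2)%N).

Definition btype := {t : seq block | sorted block_ge t}.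

Definition weight (t : btype) : nat := (\sum_(b <- val t) b.1 * b.2)%N.

Definition blk (t : btype) (i : 'I_(size (val t))) : block :=
  tnth (in_tuple (val t)) i.

Definition mults (t : btype) (k : nat) : seq posn :=
  [seq b.2 | b : block <- val t & val b.1 == k].

Lemma mults_sorted t k : sorted (fun a b : posn => (b <= a)%N) (mults t k).
Proof.
have bge_trans : transitive block_ge.
  move=> y x z; rewrite /block_ge.
  case/orP=> [h|/andP[/eqP-> h]]; case/orP=> [h'|/andP[/eqP e h']].
  - by rewrite (ltn_trans h' h).
  - by rewrite -e h.
  - by rewrite h'.
  - by rewrite -e eqxx (leq_trans h' h) orbT.
rewrite /mults sorted_map.
have := sorted_filter bge_trans (fun b : block => val b.1 == k) (valP t).
apply: (@sub_in_sorted _ (fun b : block => val b.1 == k)).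
  move=> b c /eqP hb /eqP hc.
  by rewrite /block_ge /nat_of_posn hb hc ltnn => /andP[].
exact: filter_all.
Qed.

(* [restr t k] is the partition t|_k. *)
Definition restr (t : btype) (k : nat) : intpart :=
  exist _ (mults t k) (mults_sorted t k).

(* The pair (k, j) indexes the variable x_{k,j}. *)
Definition pvar := (posn * posn)%type.

Definition vdeg (v : pvar) : nat := v.1.

Definition monom := {cmonom pvar}.

Definition wdeg (M : monom) : nat := (\sum_(v <- finsupp M) vdeg v * M v)%N.

(* A formal series over the rationals in all the x_{k,j} is given by its
   coefficients.  Their product is [smul], not the pointwise product of
   functions. *)
Definition series := monom -> rat.

Local Open Scope ring_scope.

Definition sone : series := fun M => (M == mone)%:R.

(* The index set is finite, so that this is the Cauchy product. *)
Definition smul (f g : series) : series := fun M =>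
  \sum_(p \in [set p : monom * monom | mmul p.1 p.2 = M]) f p.1 * g p.2.

(* The substitution x_{k,j} |-> x_{k,j}^r, which turns each monomial N of f
   into N^r. *)
Definition ssubst (r : posn) (f : series) : series := fun M =>
  \sum_(N \in [set N : monom | expcmn N r = M]) f N.

(* The monomial symmetric function m_l in the variables x_{k,1}, x_{k,2}, ... *)
Definition mono_sym (k : nat) (l : intpart) : series := fun M =>
  (all (fun v => vdeg v == k) (finsupp M)
   && perm_eq [seq M v | v <- finsupp M] [seq nat_of_posn p | p <- val l])%:R.

(* For k > weight t the partition t|_k is empty, and its factor is 1. *)
Definition mtensor (t : btype) : series :=
  \big[smul/sone]_(1 <= k < (weight t).+1) mono_sym k (restr t k).

Definition Hdeg (d : nat) : series := fun M => (wdeg M == d)%:R.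

Definition Hblock (b : block) : series := ssubst b.2 (Hdeg b.1).

Definition Htype (s : btype) : series := \big[smul/sone]_(b <- val s) Hblock b.

(* Coefficients of the expansion of f in terms of the mtensor t, for t of weight
   n (a finite set of t), determined on these t because the mtensor t form a
   basis of the polysymmetric functions of degree n; the default value is only
   taken when f has no such expansion. *)
Definition mtensor_coef (n : nat) (f : series) : btype -> rat :=
  xget (fun=> 0) [set a : btype -> rat |
    forall M, f M =
      \sum_(t \in [set t : btype | weight t = n]) a t * mtensor t M].

Definition trans_H_m (t s : btype) : rat := mtensor_coef (weight s) (Htype s) t.

(* A brick labelled i has length r_i, where s = (d_1^{r_1}, d_2^{r_2}, ...);
   hence a row covered by bricks amounts to the sequence of their labels from
   left to right, labels being numbered from 0. *)
Definition brick_row (s : btype) := seq 'I_(size (val s)).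

Definition row_length (s : btype) (w : brick_row s) : nat :=
  (\sum_(i <- w) (blk i).2)%N.

(* [T k] lists the covered rows of the k-th component, from top to bottom. *)
Definition HTBT (t s : btype) : set (posn -> seq (brick_row s)) :=
  [set T |
    [/\ forall k : posn, map (@row_length s) (T k)
          = map nat_of_posn (val (restr t k)),
        forall (k : posn) (w : brick_row s), w \in T k ->
          sorted (fun i j : 'I_(size (val s)) => (i <= j)%N) w
      & exists lam : 'I_(size (val s)) -> intpart,
          (forall i, psize (lam i) = (blk i).1)
          /\ (forall (k : posn) i,
                count_mem i (flatten (T k)) = count_mem k (val (lam i)))]].

Arguments HTBT : clear implicits.

(* Main.v *)
Require Import Defs.
From mathcomp Require Import all_boot all_order all_algebra.
From mathcomp Require Import finmap.
From mathcomp Require Import boolp classical_sets functions cardinality fsbigop.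
From mathcomp Require Import monalg.

Set Implicit Arguments.
Unset Strict Implicit.
Unset Printing Implicit Defensive.

Import GRing.Theory Num.Theory.

Local Open Scope classical_set_scope.
Local Open Scope ring_scope.

(** The multiset of the pairs (degree of v, exponent of v), for v ranging over
    the variables of a monomial M, is a type, [mtype M].  The theorem is an
    identity between two functions of M, read through this type.

    On one side, the factor of the tensor monomial function of t in degree k
    prescribes the exponents of the variables of degree k up to order, and
    distinct degrees involve disjoint sets of variables; hence the coefficient
    of M in it is 1 if M has type t and 0 otherwise ([mtensorE]).  An expansion
    of a series f with coefficients a thus says that the coefficient of M in f
    is a (mtype M) when M has degree n, and 0 for the other M.  As every type is
    the type of some monomial ([mtype_surj]), a is determined on the types of
    weight n.

    On the other side, for s = (d_1^{r_1}, ..., d_s^{r_s}), the coefficient of M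
    in H_s is the number of factorizations of M as a product of powers
    N_i^{r_i} with N_i of degree d_i ([Htype_cnt]).  Such a factorization is a
    tabloid: the variables of M label the rows of the tensor diagram of its type,
    the row of v has M(v) = sum_i r_i N_i(v) boxes, and covering it by N_i(v)
    bricks of length r_i and label i, in increasing order of labels, leaves no
    choice.  The condition that N_i has degree d_i says that the degrees of its
    variables, repeated according to their exponents, form a partition of d_i,
    and its parts equal to k count the bricks labelled i in the k-th component.
    This bijection ([tabloid_of_bij]) gives the coefficient of M in H_s as a
    number of tabloids depending on the type of M only, which is the required
    expansion. *)

(** * Counting finite sets by sums *)

Lemma fsbig_single (I : choiceType) (A : set I) (F : I -> rat) (x : I) :
  A x -> (forall y, A y -> y != x -> F y = 0) -> \sum_(y \in A) F y = F x.
Proof.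
move=> Ax F0; rewrite (fsbigE [:: x]) //=.
- by rewrite big_cons big_nil mem_set // addr0.
- by move=> y /=; rewrite inE => /eqP ->.
- by move=> y Ay; rewrite inE => /F0 ->.
Qed.

(** The cardinality of a finite set as a sum of ones: this form goes through
    products, dependent pairs and bijections by the theory of finitely
    supported sums. *)
Definition cnt (I : choiceType) (A : set I) : rat := \sum_(x \in A) (1 : rat).

Lemma cntE (I : choiceType) (A : set I) :
  finite_set A -> cnt A = (#|` fset_set A|%fset)%:R.
Proof.
by move=> Afin; rewrite /cnt fsbig_finite // card_fset_sum1 natr_sum.
Qed.

Lemma cnt_bij (I J : choiceType) (A : set I) (B : set J) (h : I -> J) :
  set_bij A B h -> cnt B = cnt A.
Proof. by move=> hbij; rewrite /cnt (reindex_fsbig h A). Qed.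

Lemma finite_bij (I J : choiceType) (A : set I) (B : set J) (h : I -> J) :
  set_bij A B h -> finite_set A -> finite_set B.
Proof.
case=> /image_subP hAB _ hsurj; rewrite -(surj_image_eq hAB hsurj).
exact: finite_image.
Qed.

Lemma cnt_prod (I J : choiceType) (A : set I) (B : set J) :
  finite_set A -> finite_set B -> cnt A * cnt B = cnt (A `*` B).
Proof.
move=> Afin Bfin; rewrite /cnt -(@pair_fsbig _ _ _ _ _ A B (fun _ _ => 1 : rat)) //.
by rewrite mulr_fsuml; apply: eq_fsbigr => i _; rewrite mul1r.
Qed.

Definition dep_pairs (I J : choiceType) (A : set I) (B : I -> set J) :=
  [set p : I * J | A p.1 /\ B p.1 p.2].

Lemma finite_dep_pairs (I J : choiceType) (A : set I) (B : I -> set J) :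
  finite_set A -> (forall i, finite_set (B i)) -> finite_set (dep_pairs A B).
Proof.
move=> Afin Bfin; apply: (@sub_finite_set _ _ (A `*` \bigcup_(i in A) B i)).
  by move=> [i j] /= [Ai Bij]; split => //=; exists i.
by apply: finite_setX => //; apply: bigcup_finite.
Qed.

Lemma cnt_dep_pairs (I J : choiceType) (A : set I) (B : I -> set J) :
  finite_set A -> (forall i, finite_set (B i)) ->
  \sum_(i \in A) cnt (B i) = cnt (dep_pairs A B).
Proof.
move=> Afin Bfin; set C := \bigcup_(i in A) B i.
have Cfin : finite_set C by apply: bigcup_finite.
have -> : dep_pairs A B = (A `*` C) `&` [set p | B p.1 p.2].
  apply/seteqP; split=> [[i j] [/= Ai Bij]|[i j] [[/= Ai _] Bij]] //.
  by split => //; split => //; exists i.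
rewrite /cnt fsbig_mkcondr.
rewrite -(@pair_fsbig _ _ _ _ _ A C
  (fun i j => if (i, j) \in [set p | B p.1 p.2] then 1 else 0 : rat)) //=.
apply: eq_fsbigr => i; rewrite inE => Ai.
have {1}-> : B i = C `&` B i.
  by apply/seteqP; split=> [j Bij|j []] //; split => //; exists i.
by rewrite fsbig_mkcondr; exact: eq_fsbigr.
Qed.

(** * Monomials *)

Lemma cmonomP (M N : monom) : (forall v, M v = N v) -> M = N.
Proof. by move=> eqMN; apply/eqP/cmP. Qed.

Lemma expcmnE (N : monom) (r : nat) v : expcmn N r v = (r * N v)%N.
Proof.
rewrite /expcmn; case: r => [|r]; first by rewrite onecmE mul0n.
by rewrite iteropS; elim: r => [|r IHr] /=; rewrite ?mul1n // mulcmE IHr mulSn.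
Qed.

Definition mkmon (A : {fset pvar}) (c : pvar -> nat) : monom :=
  mkcmonom [fsfun v in A => c v | 0%N].

Lemma mkmonE A c v : mkmon A c v = if v \in A then c v else 0%N.
Proof. by rewrite cmE fsfun_fun. Qed.

Lemma finsupp_mkmon A c : (finsupp (mkmon A c) `<=` A)%fset.
Proof. by apply/fsubsetP => v; rewrite -cmE_neq0 mkmonE; case: ifP. Qed.

(** A divisor of M is determined by its exponents on the support of M, which
    are bounded. *)
Lemma finite_divisors (M : monom) :
  finite_set [set N : monom | forall v, (N v <= M v)%N].
Proof.
pose B := (\max_(v <- finsupp M) M v)%N.
pose h (f : {ffun finsupp M -> 'I_B.+1}) :=
  mkmon (finsupp M) (fun v => if insub v is Some u then f u : nat else 0%N).
apply: (@sub_finite_set _ _ (h @` setT)); last first.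
  by apply: finite_image; exact: finite_finset.
move=> N /= leNM; exists [ffun u => inord (N (val u))] => //.
apply: cmonomP => v; rewrite mkmonE; case: ifP => [vM|/negbT vM].
  rewrite insubT ffunE /= inordK // ltnS (leq_trans (leNM v)) //.
  exact: leq_bigmax_seq.
by apply/esym/eqP; rewrite -leqn0 (leq_trans (leNM v)) // leqn0 cmE_eq0.
Qed.

Definition factor_pairs (M : monom) :=
  [set p : monom * monom | mmul p.1 p.2 = M].

(** The index set of the Cauchy product is finite, so that sums over it, which
    are 0 by convention when their support is infinite, have their ordinary
    meaning. *)
Lemma finite_factor_pairs (M : monom) : finite_set (factor_pairs M).
Proof.
have D := finite_divisors M; apply: sub_finite_set (finite_setX D D).
by move=> [N N'] /= <-; split=> v /=; rewrite cmM ?leq_addr ?leq_addl.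
Qed.

Lemma wdegEw (M : monom) (A : {fset pvar}) : (finsupp M `<=` A)%fset ->
  wdeg M = (\sum_(v <- A) vdeg v * M v)%N.
Proof.
move=> sMA; rewrite /wdeg (big_fset_incl _ sMA) // => v _.
by rewrite -cmE_neq0 negbK => /eqP ->; rewrite muln0.
Qed.

Lemma wdeg1 : wdeg mone = 0%N.
Proof. by rewrite /wdeg mdom1 big_seq_fset0. Qed.

Lemma wdegM (M N : monom) : wdeg (mmul M N) = (wdeg M + wdeg N)%N.
Proof.
rewrite {1}/wdeg mdomD (wdegEw (fsubsetUl _ (finsupp N))).
rewrite (wdegEw (fsubsetUr (finsupp M) _)) -big_split /=.
by apply: eq_bigr => v _; rewrite cmM mulnDr.
Qed.

Lemma wdegX (N : monom) (r : nat) : wdeg (expcmn N r) = (r * wdeg N)%N.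
Proof.
rewrite (@wdegEw _ (finsupp N)); last first.
  apply/fsubsetP => v; rewrite -!cmE_neq0 expcmnE.
  by apply: contraNneq => ->; rewrite muln0.
by rewrite /wdeg big_distrr /=; apply: eq_bigr => v _; rewrite expcmnE mulnCA.
Qed.

(** * The tensor monomial functions are indicators *)

Definition mrestr (P : pred pvar) (M : monom) : monom :=
  mkmon (finsupp M) (fun v => if P v then M v else 0%N).

Lemma mrestrE P M v : mrestr P M v = if P v then M v else 0%N.
Proof.
by rewrite mkmonE; case: ifP => // /negbT; rewrite -cmE_eq0 => /eqP ->; case: ifP.
Qed.

Lemma perm_finsupp_mrestr P M :
  perm_eq (finsupp (mrestr P M)) [seq v <- finsupp M | P v].
Proof.
apply: uniq_perm; rewrite ?filter_uniq ?fset_uniq // => v.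
rewrite mem_filter -!cmE_neq0 mrestrE.
by case: (P v).
Qed.

(** When f and g involve disjoint sets of variables, only one factorization
    of M contributes to the coefficient of M in the product. *)
Lemma smul_disjoint (P : pred pvar) (f g : series) M :
    (forall N, f N != 0 -> {subset finsupp N <= P}) ->
    (forall N, g N != 0 -> {subset finsupp N <= predC P}) ->
  smul f g M = f (mrestr P M) * g (mrestr (predC P) M).
Proof.
move=> fP gP.
rewrite /smul (@fsbig_single _ _ _ (mrestr P M, mrestr (predC P) M)) //=.
  by apply: cmonomP => v; rewrite cmM !mrestrE /=; case: (P v); rewrite ?addn0.
move=> [N N'] /= defM; apply: contra_neqP => /eqP.
rewrite mulf_eq0 negb_or => /andP[/fP NP /gP N'P].
have N0 v : ~~ P v -> N v = 0%N.
  by move=> Pv; apply/eqP; rewrite cmE_eq0; apply: contra Pv => /NP.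
have N'0 v : P v -> N' v = 0%N.
  by move=> Pv; apply/eqP; rewrite cmE_eq0; apply/negP => /N'P /negP.
apply/eqP; rewrite xpair_eqE -defM.
apply/andP; split; apply/cmP => v; rewrite mrestrE cmM /=;
  have [Pv|Pv] := boolP (P v); rewrite //=.
- by rewrite N'0 ?addn0.
- exact: N0.
- exact: N'0.
- by rewrite N0.
Qed.

Local Notation mono_sym := Defs.mono_sym.

Definition expts (M : monom) (k : nat) : seq nat :=
  [seq M v | v <- finsupp M & vdeg v == k].

Lemma perm_expts_mrestr (P : pred pvar) M k :
  (forall v, vdeg v == k -> P v) -> perm_eq (expts (mrestr P M) k) (expts M k).
Proof.
move=> kP; rewrite /expts.
rewrite (_ : map _ _ = [seq M v | v <- finsupp (mrestr P M) & vdeg v == k]); last first.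
  apply/eq_in_map => v.
  by rewrite mem_filter mrestrE => /andP[/kP ->].
have /permPl -> := perm_map M (perm_filter (fun v => vdeg v == k)
  (perm_finsupp_mrestr P M)).
rewrite -filter_predI.
rewrite (eq_filter (a2 := fun v => vdeg v == k)) // => v /=.
by apply: andb_idr => /kP.
Qed.

Lemma mono_symE k l M : mono_sym k l M =
  (all (fun v => vdeg v == k) (finsupp M)
   && perm_eq (expts M k) (map nat_of_posn (val l)))%:R.
Proof.
rewrite /mono_sym /expts; case: (boolP (all _ _)) => // /all_filterP.
by move=> ->.
Qed.

(** By induction on the list of degrees: the factor of degree k and the product
    of the others involve disjoint sets of variables, as the degrees in the list
    are distinct. *)
Lemma prod_mono_symE (l : nat -> intpart) (ks : seq nat) M : uniq ks ->
  (\big[smul/sone]_(k <- ks) mono_sym k (l k)) M =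
  (all (fun v => vdeg v \in ks) (finsupp M)
   && all (fun k => perm_eq (expts M k) (map nat_of_posn (val (l k)))) ks)%:R.
Proof.
elim: ks M => [|k ks IHks] M /=.
  rewrite big_nil /sone andbT => _; congr (nat_of_bool _)%:R.
  apply/eqP/allP => [-> v|M0]; first by rewrite mdom1.
  by apply: cmonomP => v; rewrite cm1; apply/eqP; rewrite cmE_eq0; apply/negP => /M0.
case/andP => kNks /IHks {}IHks; rewrite big_cons.
rewrite (@smul_disjoint (fun v => vdeg v == k)); first last.
- move=> N; rewrite IHks pnatr_eq0 eqb0 negbK => /andP[/allP Nks _] v /Nks vks.
  by rewrite inE; apply: contraNN kNks => /eqP <-.
- by move=> N; rewrite mono_symE pnatr_eq0 eqb0 negbK => /andP[/allP].
rewrite IHks mono_symE -natrM mulnb; congr (nat_of_bool _)%:R.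
rewrite (permPl (perm_expts_mrestr _ _)) //.
rewrite !(perm_all _ (perm_finsupp_mrestr _ _)) !all_filter.
rewrite (_ : all _ (finsupp M) = true) /=; last by apply/allP => v _; exact: implybb.
rewrite andbCA; congr [&& _, _ & _].
  by apply: eq_all => v /=; rewrite inE; case: eqP.
apply: eq_in_all => k' k'ks; rewrite (permPl (perm_expts_mrestr _ _)) //.
by move=> v /eqP vk'; rewrite inE vk'; apply: contraNneq kNks => <-.
Qed.

(** * The type of a monomial *)

Lemma block_ge_trans : transitive block_ge.
Proof.
move=> y x z; rewrite /block_ge.
case/orP=> [h|/andP[/eqP-> h]]; case/orP=> [h'|/andP[/eqP e h']].
- by rewrite (ltn_trans h' h).
- by rewrite -e h.
- by rewrite h'.
- by rewrite -e eqxx (leq_trans h' h) orbT.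
Qed.

Lemma block_ge_total : total block_ge.
Proof.
move=> [a b] [c d]; rewrite /block_ge /= -!val_eqE /=.
by case: ltngtP => //= _; exact: leq_total.
Qed.

Lemma block_ge_anti : antisymmetric block_ge.
Proof.
move=> [a b] [c d]; rewrite /block_ge /= -!val_eqE /=.
case: ltngtP => //= /val_inj -> bd.
by congr (_, _); apply/val_inj/anti_leq; rewrite andbC.
Qed.

Definition posnS (n : nat) : posn := exist _ n.+1 isT.

(** The block d^m contributed to the type of M by the variable v of degree d with
    exponent m; the default value is taken only outside the support of M. *)
Definition vblock (M : monom) (v : pvar) : block := (v.1, insubd (posnS 0) (M v)).

Lemma vblockE (M : monom) v : v \in finsupp M -> (vblock M v).2 = M v :> nat.
Proof. by rewrite -cmE_neq0 -lt0n => Mv; rewrite /vblock /nat_of_posn insubdK. Qed.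

Lemma mtype_subproof M :
  sorted block_ge (sort block_ge [seq vblock M v | v <- finsupp M]).
Proof. exact/sort_sorted/block_ge_total. Qed.

Definition mtype (M : monom) : btype :=
  exist (fun t => is_true (sorted block_ge t)) _ (mtype_subproof M).

Lemma perm_mtype M : perm_eq (val (mtype M)) [seq vblock M v | v <- finsupp M].
Proof. by rewrite perm_sort. Qed.

Lemma mtypeP M (t : btype) :
  (mtype M == t) = perm_eq [seq vblock M v | v <- finsupp M] (val t).
Proof.
rewrite -(permPl (perm_mtype M)); apply/eqP/idP => [-> //|pMt].
apply: val_inj.
exact: (sorted_eq block_ge_trans block_ge_anti (valP _) (valP t) pMt).
Qed.

Lemma weight_mtype M : weight (mtype M) = wdeg M.
Proof.
rewrite /weight (perm_big _ (perm_mtype M)) big_map.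
rewrite big_seq [RHS]big_seq; apply: eq_bigr => v /vblockE ->.
by [].
Qed.

(** The block k^m occurs in a sequence as often as m occurs among the
    multiplicities of its blocks of degree k. *)
Lemma perm_blocks (A B : seq block) :
  (forall k : nat, perm_eq [seq b.2 | b <- A & val b.1 == k]
                           [seq b.2 | b <- B & val b.1 == k]) ->
  perm_eq A B.
Proof.
move=> AB; apply/allP => -[k m] _; apply/eqP.
have countE (C : seq block) :
    count_mem (k, m) C = count_mem m [seq b.2 | b <- C & val b.1 == val k].
  rewrite count_map count_filter; apply: eq_count => -[k' m'] /=.
  by rewrite xpair_eqE val_eqE andbC.
by rewrite !countE; move/permP: (AB (val k)); apply.
Qed.

Lemma expts_vblock M k : expts M k =
  map nat_of_posn [seq b.2 | b <- [seq vblock M v | v <- finsupp M] & val b.1 == k].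
Proof.
rewrite filter_map -!map_comp; apply/eq_in_map => v.
by rewrite mem_filter => /andP[_ /vblockE].
Qed.

Lemma nat_of_posn_inj : injective nat_of_posn.
Proof. exact: val_inj. Qed.

Lemma degree_le_weight (t : btype) (b : block) : b \in val t -> (b.1 <= weight t)%N.
Proof.
move=> bt; rewrite /weight (big_rem b) //= (leq_trans _ (leq_addr _ _)) //.
by rewrite leq_pmulr // (valP b.2).
Qed.

(** The factors of the tensor monomial function prescribe the exponents of M
    degree by degree, up to the order of the variables; together they
    prescribe exactly the type of M. *)
Lemma mtensorE (t : btype) M : mtensor t M = (mtype M == t)%:R.
Proof.
rewrite /mtensor prod_mono_symE ?iota_uniq // mtypeP; congr (nat_of_bool _)%:R.
apply/andP/idP => [[/allP Mle /allP pM]|pMt].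
  apply: perm_blocks => k; apply: (perm_map_inj nat_of_posn_inj).
  rewrite -expts_vblock.
  have [kt|kNt] := boolP (k \in index_iota 1 (weight t).+1); first exact: pM.
  have filter0 (T : eqType) (a : pred T) r : {in r, a =1 pred0} -> filter a r = [::].
    by move/eq_in_filter ->; exact: filter_pred0.
  rewrite /expts filter0 => [|v /Mle vle]; last first.
    by apply: contraNF kNt => /eqP <-.
  rewrite filter0 // => b /degree_le_weight bt.
  by apply: contraNF kNt => /eqP <-; rewrite mem_index_iota ltnS bt (valP b.1).
split; [apply/allP => v vM | apply/allP => k _].
  rewrite mem_index_iota ltnS (valP v.1) /=.
  apply: (@degree_le_weight t (vblock M v)).
  by rewrite -(perm_mem pMt) map_f.
by rewrite expts_vblock perm_map // perm_map // perm_filter.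
Qed.

(** A monomial with one variable for each block, of the degree of the block and
    with its multiplicity as exponent. *)
Lemma mtype_surj (t : btype) : exists M, mtype M = t.
Proof.
pose b0 : block := (posnS 0, posnS 0); pose n := size (val t).
(* One variable per block, made distinct by the position of the block. *)
pose var j : pvar := ((nth b0 (val t) j).1, posnS j).
pose c (v : pvar) : nat := (nth b0 (val t) (v.2 : nat).-1).2.
pose vars := [seq var j | j <- iota 0 n].
have uvars : uniq vars by rewrite map_inj_uniq ?iota_uniq // => i j [].
pose M := mkmon [fset v in vars]%fset c.
have ME v : M v = if v \in vars then c v else 0%N by rewrite mkmonE in_fset.
have pM : perm_eq (finsupp M) vars.
  apply: uniq_perm => // v; rewrite -cmE_neq0 ME; case: ifP => // _.
  by rewrite -lt0n; exact: (valP (nth b0 _ _).2).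
exists M; apply/eqP; rewrite mtypeP (permPl (perm_map _ pM)) -map_comp.
suff -> : [seq (vblock M \o var) j | j <- iota 0 n] = val t by [].
rewrite -[RHS](mkseq_nth b0); apply/eq_in_map => j jn /=.
rewrite /vblock ME map_f //= [RHS]surjective_pairing; congr (_, _).
by apply: nat_of_posn_inj; rewrite /nat_of_posn insubdK //=; exact: (valP (nth b0 _ _).2).
Qed.

(** Each monomial occurs in exactly one of the tensor monomial functions, the one
    of its own type.  Hence an expansion can be read off monomial by monomial. *)
Lemma mtensor_expansionE (n : nat) (a : btype -> rat) M :
  \sum_(t \in [set t : btype | weight t = n]) a t * mtensor t M =
  if wdeg M == n then a (mtype M) else 0.
Proof.
case: eqP => [Mn|MNn].
  rewrite (@fsbig_single _ _ _ (mtype M)) /= ?weight_mtype //.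
    by rewrite mtensorE eqxx mulr1.
  by move=> t _ /negPf tM; rewrite mtensorE eq_sym tM mulr0.
rewrite fsbig1 // => t /= tn; rewrite mtensorE.
by case: eqP => [Mt|]; rewrite ?mulr0 //; case: MNn; rewrite -weight_mtype Mt.
Qed.

(** * Coefficients of H as numbers of factorizations *)

Definition block_roots (b : block) (M : monom) : set monom :=
  [set N : monom | expcmn N b.2 = M /\ wdeg N = b.1].

Definition factorizations (bs : seq block) (M : monom) : set (seq monom) :=
  [set Ns | map wdeg Ns = [seq nat_of_posn b.1 | b <- bs]
    /\ \big[mmul/mone]_(p <- zip bs Ns) expcmn p.2 p.1.2 = M].

Lemma finite_block_roots b M : finite_set (block_roots b M).
Proof.
apply: sub_finite_set (finite_divisors M) => N [<- _] v /=.
by rewrite expcmnE leq_pmull // (valP b.2).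
Qed.

Lemma Hblock_cnt b M : Hblock b M = cnt (block_roots b M).
Proof.
rewrite /Hblock /ssubst /cnt.
have -> : block_roots b M
  = [set N : monom | expcmn N b.2 = M] `&` [set N | wdeg N = b.1] by [].
rewrite fsbig_mkcondr; apply: eq_fsbigr => N _; rewrite /Hdeg.
by case: eqP => Nb; [rewrite mem_set | rewrite memNset].
Qed.

(** The two factors of M need not be recorded: they are recovered as the power
    of N and the product along Ns. *)
Lemma factorizations_cons b bs M :
  set_bij (dep_pairs (factor_pairs M)
             (fun p => block_roots b p.1 `*` factorizations bs p.2))
          (factorizations (b :: bs) M) (fun x => x.2.1 :: x.2.2).
Proof.
split.
- move=> [[P Q] [N Ns]] [/= PQ [[NP Nb] [/= Nsbs NsQ]]].
  by split; rewrite /= ?Nb ?Nsbs //= big_cons NsQ /= NP.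
- move=> [[P Q] [N Ns]] [[P' Q'] [N' Ns']] /set_mem [_ [[/= NP _] [_ /= NsQ]]].
  move=> /set_mem [_ [[/= NP' _] [_ /= NsQ']]] /= [eqN eqNs].
  by rewrite -NP -NP' -NsQ -NsQ' eqN eqNs.
- move=> [|N Ns] [//= [Nb Nsbs]]; rewrite big_cons /= => defM.
  by exists ((expcmn N b.2,
              \big[mmul/mone]_(p <- zip bs Ns) expcmn p.2 p.1.2), (N, Ns)).
Qed.

Lemma factorizations_nil M :
  factorizations [::] M = if M == mone then [set [::]] else set0.
Proof.
apply/seteqP; split=> [[|N Ns] [//= _]|Ns].
  by rewrite big_nil => <-; rewrite eqxx.
by case: eqP => //= -> ->; split=> //=; rewrite big_nil.
Qed.

Lemma finite_factorizations bs M : finite_set (factorizations bs M).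
Proof.
elim: bs M => [|b bs IHbs] M.
  by rewrite factorizations_nil; case: ifP => _; [exact: finite_set1|].
apply: finite_bij (factorizations_cons b bs M) _.
apply: finite_dep_pairs; first exact: finite_factor_pairs.
by move=> p; apply: finite_setX => //; exact: finite_block_roots.
Qed.

(** By induction on the blocks: multiplication by H of a block sums over the pairs
    of factors, and choosing a root of the first factor and a factorization of the
    second amounts to choosing a longer factorization. *)
Lemma Htype_cnt (s : btype) M : Htype s M = cnt (factorizations (val s) M).
Proof.
rewrite /Htype; elim: (val s) M => [|b bs IHbs] M.
  rewrite big_nil factorizations_nil /sone /cnt.
  by case: eqP; rewrite ?fsbig_set1 ?fsbig_set0.
rewrite big_cons (cnt_bij (factorizations_cons b bs M)) -cnt_dep_pairs.
- rewrite /smul; apply: eq_fsbigr => p _; rewrite IHbs Hblock_cnt cnt_prod //.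
    exact: finite_block_roots.
  exact: finite_factorizations.
- exact: finite_factor_pairs.
- move=> p; apply: finite_setX; first exact: finite_block_roots.
  exact: finite_factorizations.
Qed.

Lemma wdeg_factorization bs M Ns : factorizations bs M Ns ->
  wdeg M = (\sum_(b <- bs) b.1 * b.2)%N.
Proof.
case=> + <-; elim: bs Ns => [|b bs IHbs] [|N Ns] //=; first by rewrite !big_nil wdeg1.
by case=> Nb /IHbs Nsbs; rewrite !big_cons wdegM wdegX Nsbs /= Nb mulnC.
Qed.

(** Needed for the expansion to hold also at the monomials of the other degrees,
    which do not occur in the tensor monomial functions of weight n. *)
Lemma Htype_eq0 (s : btype) M : wdeg M <> weight s -> Htype s M = 0.
Proof.
move=> Ms; rewrite Htype_cnt /cnt fsbig1 // => Ns /wdeg_factorization.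
by move/Ms.
Qed.

(** The description of factorizations by exponents, each variable separately:
    the equation for v is what a covering of a row of M(v) boxes by bricks of
    lengths r_i must satisfy. *)
Lemma factorizationsP (s : btype) M Ns : factorizations (val s) M Ns <->
  [/\ size Ns = size (val s),
      forall i : 'I_(size (val s)), wdeg (nth mone Ns i) = (blk i).1
    & forall v, M v = (\sum_(i < size (val s)) (blk i).2 * nth mone Ns i v)%N].
Proof.
pose b0 : block := (posnS 0, posnS 0).
have blkE (i : 'I_(size (val s))) : blk i = nth b0 (val s) i by exact: tnth_nth.
have prodE v : size Ns = size (val s) ->
    (\big[mmul/mone]_(p <- zip (val s) Ns) expcmn p.2 p.1.2) v
    = (\sum_(i < size (val s)) (blk i).2 * nth mone Ns i v)%N.
  move=> sNs; pose ev (N : monom) := N v.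
  rewrite -/(ev _) (@big_morph _ _ ev 0%N addn) => [|N N'|]; last 2 first.
  - exact: cmM.
  - exact: cm1.
  rewrite (big_nth (b0, mone)) size1_zip ?sNs // big_mkord.
  by apply: eq_bigr => i _; rewrite nth_zip //= /ev expcmnE blkE.
split=> [[Nss defM]|[sNs Nss defM]].
  have sNs : size Ns = size (val s) by rewrite -(size_map wdeg) Nss size_map.
  split=> // [i|v]; last by rewrite -defM prodE.
  by rewrite -(nth_map _ 0%N) ?sNs // Nss (nth_map b0) // blkE.
split; last by apply: cmonomP => v; rewrite prodE.
apply: (@eq_from_nth _ 0%N); rewrite ?size_map // => i; rewrite sNs => lt_i.
by rewrite (nth_map mone) ?sNs // (nth_map b0) // (Nss (Ordinal lt_i)) blkE.
Qed.

(** * Brick rows *)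

Section Rows.
Variable s : btype.
Notation label := 'I_(size (val s)).

Definition le_label (i j : label) : bool := (i <= j)%N.

Definition row_of (c : label -> nat) : brick_row s :=
  sort le_label (flatten [seq nseq (c i) i | i <- enum 'I_(size (val s))]).

Lemma count_row_of c i : count_mem i (row_of c) = c i.
Proof.
rewrite /row_of; have /permP -> := permEl (perm_sort le_label
  (flatten [seq nseq (c i) i | i <- enum 'I_(size (val s))])).
rewrite count_flatten -map_comp sumnE big_map big_enum /= (bigD1 i) //=.
rewrite count_nseq /= eqxx mul1n big1 ?addn0 // => j /negPf ji.
by rewrite count_nseq /= ji.
Qed.

Lemma sorted_row_of c : sorted le_label (row_of c).
Proof. by apply: sort_sorted => i j; exact: leq_total. Qed.

(** As labels increase along a row, the numbers of bricks of each label leave no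
    freedom; without this order, a factorization would give many tabloids. *)
Lemma row_ofE (w : brick_row s) :
  sorted le_label w -> row_of (fun i => count_mem i w) = w.
Proof.
move=> w_sorted; apply: (@sorted_eq _ le_label) => //.
- by move=> j i k; exact: leq_trans.
- by move=> i j /anti_leq /val_inj.
- exact: sorted_row_of.
- by apply/allP => i _; rewrite /= count_row_of.
Qed.

Lemma row_length_count (w : brick_row s) :
  row_length w = (\sum_(i < size (val s)) (blk i).2 * count_mem i w)%N.
Proof.
elim: w => [|j w IHw]; rewrite /row_length ?big_nil ?big_cons.
  by rewrite big1 // => i _; rewrite muln0.
rewrite -/(row_length w) IHw [in RHS](eq_bigr (fun i : label =>
  (blk i).2 * (j == i) + (blk i).2 * count_mem i w)%N) => [|i _]; last first.
  by rewrite mulnDr.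
rewrite big_split /=; congr addn; rewrite (bigD1 j) //= eqxx muln1.
by rewrite big1 ?addn0 // => i /negPf; rewrite eq_sym => ->; rewrite muln0.
Qed.

End Rows.

(** * From factorizations to tabloids *)

(** The variables of degree k of M, ordered so that their exponents are the
    parts of the k-th component of the type of M. *)
Definition row_vars (M : monom) (k : posn) : seq pvar :=
  [seq v <- sort (relpre (vblock M) block_ge) (finsupp M) | v.1 == k].

Lemma row_vars_uniq M k : uniq (row_vars M k).
Proof. by rewrite filter_uniq // sort_uniq fset_uniq. Qed.

Lemma mem_row_vars M k v : (v \in row_vars M k) = (v.1 == k) && (v \in finsupp M).
Proof. by rewrite mem_filter mem_sort. Qed.

Lemma map_row_vars (M : monom) k :
  [seq M v | v <- row_vars M k] = map nat_of_posn (val (restr (mtype M) k)).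
Proof.
rewrite /row_vars /= /mults /= sort_map filter_map -!map_comp.
apply/eq_in_map => v.
by rewrite mem_filter mem_sort => /andP[_ /vblockE].
Qed.

(** The degrees of the variables of N, repeated according to their exponents:
    as N ranges over the i-th factors, these are the partitions of d_i that
    prescribe how many bricks labelled i go to each component. *)
Definition var_degrees (N : monom) : seq posn :=
  flatten [seq nseq (N v) v.1 | v <- finsupp N].

Lemma sum_var_degrees N : (\sum_(k <- var_degrees N) k)%N = wdeg N.
Proof.
rewrite big_flatten big_map; apply: eq_bigr => v _ /=.
by rewrite big_nseq iter_addn_0.
Qed.

Lemma count_var_degrees (N M : monom) k : {subset finsupp N <= finsupp M} ->
  count_mem k (var_degrees N) = (\sum_(v <- row_vars M k) N v)%N.
Proof.
move=> NM; rewrite count_flatten -map_comp sumnE big_map.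
rewrite (eq_bigr (fun v => if v.1 == k then N v else 0%N)) => [|v _]; last first.
  by rewrite /= count_nseq /=; case: eqP; rewrite ?mul1n.
rewrite (big_fset_incl _ (A := finsupp N) (B := finsupp M)) /=; first last.
- by move=> v _; rewrite -cmE_eq0 => /eqP ->; case: ifP.
- exact/fsubsetP.
rewrite -big_mkcond -big_filter; apply: perm_big; apply: uniq_perm.
- by rewrite filter_uniq // fset_uniq.
- exact: row_vars_uniq.
- by move=> v; rewrite mem_row_vars mem_filter.
Qed.

Section Tabloids.
Variables (s : btype) (M : monom).
Notation label := 'I_(size (val s)).

(** Each variable of M has its row, whose length is its exponent; that row is
    covered by as many bricks labelled i as the exponent of the variable in the
    i-th factor. *)
Definition tabloid_of (Ns : seq monom) (k : posn) : seq (brick_row s) :=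
  [seq row_of (fun i : label => nth mone Ns i v) | v <- row_vars M k].

Definition row_at (T : posn -> seq (brick_row s)) (v : pvar) : brick_row s :=
  nth [::] (T v.1) (index v (row_vars M v.1)).

Lemma row_at_out T v : v \notin finsupp M -> size (T v.1) = size (row_vars M v.1) ->
  row_at T v = [::].
Proof.
move=> vNM sT; rewrite /row_at nth_default // sT leqNgt index_mem.
by rewrite mem_row_vars (negPf vNM) andbF.
Qed.

Lemma map_row_at (T : posn -> seq (brick_row s)) k :
  size (T k) = size (row_vars M k) -> [seq row_at T v | v <- row_vars M k] = T k.
Proof.
move=> sT; apply: (@eq_from_nth _ [::]); rewrite size_map // => j lt_j.
have v0 : pvar by case: (row_vars M k) lt_j.
have : nth v0 (row_vars M k) j \in row_vars M k by rewrite mem_nth.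
rewrite (nth_map v0) // mem_row_vars => /andP[/eqP vk _].
by rewrite /row_at vk index_uniq // row_vars_uniq.
Qed.

Lemma size_component (T : posn -> seq (brick_row s)) k :
  HTBT (mtype M) s T -> size (T k) = size (row_vars M k).
Proof.
case=> TM _ _; rewrite -(size_map (@row_length s)) TM -map_row_vars.
by rewrite size_map.
Qed.

(** As r_i > 0, a variable of N_i is a variable of N_i^{r_i}, hence of M. *)
Lemma factor_support Ns (i : label) : factorizations (val s) M Ns ->
  {subset finsupp (nth mone Ns i) <= finsupp M}.
Proof.
case/factorizationsP=> _ _ ME v; rewrite -!cmE_neq0 ME; apply: contraNneq => /eqP.
rewrite sum_nat_eq0 => /forallP /(_ i) /= /eqP /eqP.
by rewrite muln_eq0 eqn0Ngt (valP (blk i).2).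
Qed.

Lemma count_tabloid_of Ns k (i : label) :
  count_mem i (flatten (tabloid_of Ns k))
  = (\sum_(v <- row_vars M k) nth mone Ns i v)%N.
Proof.
rewrite count_flatten -map_comp sumnE big_map; apply: eq_bigr => v _ /=.
exact: count_row_of.
Qed.

(** The partition of d_i to be exhibited consists of the degrees of the variables
    of N_i, with repetitions. *)
Lemma tabloid_of_HTBT Ns :
  factorizations (val s) M Ns -> HTBT (mtype M) s (tabloid_of Ns).
Proof.
move=> NsM; have [_ Nss ME] := (factorizationsP _ _ _).1 NsM; split.
- move=> k; rewrite -map_row_vars -map_comp; apply: eq_map => v /=.
  rewrite row_length_count ME; apply: eq_bigr => i _.
  by rewrite count_row_of.
- by move=> k w /mapP[v _ ->]; exact: sorted_row_of.
pose deg_ge (a b : posn) := (b <= a)%N.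
have lam_sorted (i : label) :
    sorted deg_ge (sort deg_ge (var_degrees (nth mone Ns i))).
  by apply: sort_sorted => a b; exact: leq_total.
exists (fun i => exist (fun l => is_true (sorted deg_ge l)) _ (lam_sorted i)).
split=> [i|k i].
  by rewrite /psize /= (perm_big _ (permEl (perm_sort _ _))) sum_var_degrees Nss.
rewrite /= (permP (permEl (perm_sort _ _))) count_tabloid_of.
exact/esym/count_var_degrees/factor_support.
Qed.

(** The exponents of N_i on the support of M are read off as numbers of bricks;
    outside it they are all 0. *)
Lemma tabloid_of_inj : set_inj (factorizations (val s) M) tabloid_of.
Proof.
move=> Ns Ns' /set_mem NsM /set_mem Ns'M eqT.
have [sNs _ _] := (factorizationsP _ _ _).1 NsM.
have [sNs' _ _] := (factorizationsP _ _ _).1 Ns'M.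
apply: (@eq_from_nth _ mone); rewrite ?sNs // => j lt_j.
apply: cmonomP => v; pose i : label := Ordinal lt_j.
have [vM|vNM] := boolP (v \in finsupp M); last first.
  have out Ns'' : factorizations (val s) M Ns'' -> nth mone Ns'' j v = 0%N.
    move=> /(@factor_support _ i) sub; apply/eqP; rewrite cmE_eq0.
    by apply: contra vNM => /sub.
  by rewrite !out.
have /eq_in_map /(_ v) := congr1 (fun T => T v.1) eqT.
rewrite mem_row_vars eqxx => /(_ vM) /(congr1 (count_mem i)).
by rewrite !count_row_of.
Qed.

(** The exponent of v in N_i must be the number of bricks labelled i in the row
    of v.  That N_i has degree d_i holds because the partition of d_i given with
    the tabloid and the degrees of the variables of N_i have the same number of
    parts equal to k for all k, namely the number of bricks labelled i in the
    k-th component. *)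
Lemma tabloid_of_surj :
  set_surj (factorizations (val s) M) (HTBT (mtype M) s) tabloid_of.
Proof.
move=> T HT; have sT k := size_component k HT.
case: HT => TM Tsorted [lam [lam_size lam_count]].
pose N (i : label) := mkmon (finsupp M) (fun v => count_mem i (row_at T v)).
have NE i v : N i v = count_mem i (row_at T v).
  by rewrite mkmonE; case: ifPn => // vM; rewrite row_at_out.
pose Ns := [seq N i | i <- enum 'I_(size (val s))].
have NsE (i : label) : nth mone Ns i = N i.
  by rewrite (nth_map i) ?size_enum_ord // nth_ord_enum.
have defT k : tabloid_of Ns k = T k.
  rewrite -[RHS]map_row_at // /tabloid_of; apply/eq_in_map => v vk.
  rewrite -[RHS]row_ofE.
    by congr row_of; apply/funext => i; rewrite NsE NE.
  move: (vk); rewrite mem_row_vars => /andP[/eqP v1k _].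
  by apply: (Tsorted v.1); rewrite mem_nth // sT index_mem v1k.
exists Ns; last by apply/funext.
apply/factorizationsP; split.
- by rewrite size_map size_enum_ord.
- move=> i; rewrite NsE -lam_size -sum_var_degrees /psize; apply: perm_big.
  apply/allP => k _; apply/eqP; rewrite -lam_count -defT count_tabloid_of.
  rewrite (count_var_degrees (M := M)); last exact/fsubsetP/finsupp_mkmon.
  by apply: eq_bigr => v _; rewrite NsE.
move=> v; under eq_bigr do rewrite NsE NE.
rewrite -row_length_count.
have [vM|vM] := boolP (v \in finsupp M); last first.
  rewrite row_at_out // /row_length big_nil; apply/eqP.
  by rewrite cmE_eq0.
have := TM v.1; rewrite -map_row_vars -[T v.1]map_row_at // -map_comp.
move/eq_in_map/(_ v); rewrite mem_row_vars eqxx => /(_ vM) /= ->.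
by [].
Qed.

Lemma tabloid_of_bij :
  set_bij (factorizations (val s) M) (HTBT (mtype M) s) tabloid_of.
Proof.
by split; [exact: tabloid_of_HTBT|exact: tabloid_of_inj|exact: tabloid_of_surj].
Qed.

Lemma Htype_card :
  Htype s M = (#|` fset_set (HTBT (mtype M) s)|%fset)%:R.
Proof.
rewrite Htype_cnt -(cnt_bij tabloid_of_bij) cntE //.
exact: finite_bij tabloid_of_bij (finite_factorizations _ _).
Qed.

End Tabloids.

Theorem corollary64 (n : nat) (tau sigma : btype) :
  weight tau = n -> weight sigma = n ->
  trans_H_m tau sigma = (#|` fset_set (HTBT tau sigma)|%fset%:R)%R :> rat.
Proof.
move=> tau_n sigma_n; rewrite /trans_H_m /mtensor_coef.
set E := (X in xget _ X).
pose a0 (t : btype) : rat := (#|` fset_set (HTBT t sigma)|%fset)%:R.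
have Ea0 : E a0.
  move=> M; rewrite mtensor_expansionE; case: eqP => [_|]; first exact: Htype_card.
  exact: Htype_eq0.
(* Any two expansions agree at tau: evaluate them at a monomial of type tau. *)
have [M Mtau] := mtype_surj tau.
have := xgetI (fun=> 0) Ea0; move: (xget _ _) => a /(_ M).
rewrite mtensor_expansionE -weight_mtype Mtau tau_n sigma_n eqxx => <-.
by rewrite Htype_card Mtau.
Qed.
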